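(* Let $\mathbf{m}_T=(T,S,P,Q,\langle,\rangle_T,I)$ be an injective unital Morita semi-context. Then: (1) $\mathcal{V}_l(\mathbf{m}_T)=\mathbb{V}_l(\mathbf{m}_T)$ and $\mathcal{W}_l(\mathbf{m}_T)=\mathbb{W}_l(\mathbf{m}_T)$, whence $$\widehat{\mathcal{V}}_l(\mathbf{m}_T)=\widehat{\mathcal{W}}_l(\mathbf{m}_T)=\mathcal{X}_l(\mathbf{m}_T)=\mathbb{X}_l(\mathbf{m}_T)={}_I\mathcal{C}\cap\mathcal{D}_l(\mathbf{m}_T)\cap{}_I\mathcal{L}\quad\text{and}\quad \mathcal{X}_l^{*}(\mathbf{m}_T)=\mathbb{X}_l^{*}(\mathbf{m}_T).$$ (2) $\mathcal{V}_r(\mathbf{m}_T)=\mathbb{V}_r(\mathbf{m}_T)$ and $\mathcal{W}_r(\mathbf{m}_T)=\mathbb{W}_r(\mathbf{m}_T)$, whence $$\widehat{\mathcal{V}}_r(\mathbf{m}_T)=\widehat{\mathcal{W}}_r(\mathbf{m}_T)=\mathcal{X}_r(\mathbf{m}_T)=\mathbb{X}_r(\mathbf{m}_T)=\mathcal{C}_I\cap\mathcal{D}_r(\mathbf{m}_T)\cap\mathcal{L}_I\quad\text{and}\quad \mathcal{X}_r^{*}(\mathbf{m}_T)=\mathbb{X}_r^{*}(\mathbf{m}_T).$$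
   Context: All rings are associative with unity and all modules unitary. $\mathrm{Hom}_{T-}$ (resp. $\mathrm{Hom}_{-T}$) denotes left (resp. right) $T$-linear maps. All classes of modules below are regarded as full subcategories. A unital Morita semi-context $\mathbf{m}_T=(T,S,P,Q,\langle,\rangle_T,I)$ consists of rings $T,S$, a $(T,S)$-bimodule $P$, an $(S,T)$-bimodule $Q$ and a $(T,T)$-bilinear map $\langle,\rangle_T:P\otimes_S Q\to T$ with image the ideal $I$ of $T$. It is injective if $\langle,\rangle_T$ is injective. For a $(T,S)$-bimodule ${}_TU_S$: $\mathrm{Stat}^l({}_TU_S)$ is the class of left $T$-modules $K$ for which the evaluation map $U\otimes_S\mathrm{Hom}_{T-}(U,K)\to K$ is an isomorphism; $\mathrm{Adstat}^l({}_TU_S)$ is the class of left $S$-modules $L$ for which $L\to\mathrm{Hom}_{T-}(U,U\otimes_S L)$, $l\mapsto[u\mapsto u\otimes l]$, is an isomorphism; $\mathrm{Stat}^r({}_TU_S)$ is the class of right $S$-modules $K$ for which evaluation $\mathrm{Hom}_{-S}(U,K)\otimes_T U\to K$ is an isomorphism; $\mathrm{Adstat}^r({}_TU_S)$ is the class of right $T$-modules $L$ for which $L\to\mathrm{Hom}_{-S}(U,L\otimes_T U)$, $l\mapsto[u\mapsto l\otimes u]$, is an isomorphism. ${}_I\mathcal{C}$ is the class of left $T$-modules $U$ for which the multiplication map $I\otimes_T U\to U$ is an isomorphism; ${}_I\mathcal{L}$ is the class of left $T$-modules $U$ for which $U\to\mathrm{Hom}_{T-}(I,U)$, $u\mapsto[t\mapsto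 tu]$, is an isomorphism; $\mathcal{C}_I$ and $\mathcal{L}_I$ are the analogous classes of right $T$-modules ($U\otimes_T I\simeq U$, $U\simeq\mathrm{Hom}_{-T}(I,U)$ canonically). $\mathcal{D}_l(\mathbf{m}_T)$ is the class of left $T$-modules $U$ for which $Q\otimes_T U\to\mathrm{Hom}_{T-}(P,U)$, $q\otimes u\mapsto[p\mapsto\langle p,q\rangle_T u]$, is an isomorphism; $\mathcal{D}_r(\mathbf{m}_T)$ is the class of right $T$-modules $U$ for which $U\otimes_T P\to\mathrm{Hom}_{-T}(Q,U)$, $u\otimes p\mapsto[q\mapsto u\langle p,q\rangle_T]$, is an isomorphism. Left classes: $\mathcal{V}_l(\mathbf{m}_T)=\mathrm{Stat}^l({}_TP_S)\cap\mathcal{D}_l(\mathbf{m}_T)$; $\mathcal{W}_l(\mathbf{m}_T)=\mathrm{Adstat}^l({}_SQ_T)\cap\mathcal{D}_l(\mathbf{m}_T)$; $\mathbb{V}_l(\mathbf{m}_T)={}_I\mathcal{C}\cap\mathcal{D}_l(\mathbf{m}_T)$; $\mathbb{W}_l(\mathbf{m}_T)={}_I\mathcal{L}\cap\mathcal{D}_l(\mathbf{m}_T)$; $\widehat{\mathcal{V}}_l(\mathbf{m}_T)=\mathcal{V}_l(\mathbf{m}_T)\cap{}_I\mathcal{L}$; $\widehat{\mathcal{W}}_l(\mathbf{m}_T)=\mathcal{W}_l(\mathbf{m}_T)\cap{}_I\mathcal{C}$; $\mathcal{X}_l(\mathbf{m}_T)=\mathcal{V}_l(\mathbf{m}_T)\cap\mathcal{W}_l(\mathbf{m}_T)$;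 $\mathbb{X}_l(\mathbf{m}_T)=\mathbb{V}_l(\mathbf{m}_T)\cap\mathbb{W}_l(\mathbf{m}_T)$; $\mathcal{X}_l^*(\mathbf{m}_T)=\{{}_S(Q\otimes_TU)\mid U\in\mathcal{X}_l(\mathbf{m}_T)\}$; $\mathbb{X}_l^*(\mathbf{m}_T)=\{{}_S(Q\otimes_TU)\mid U\in\mathbb{X}_l(\mathbf{m}_T)\}$. Right classes: $\mathcal{V}_r(\mathbf{m}_T)=\mathrm{Stat}^r({}_SQ_T)\cap\mathcal{D}_r(\mathbf{m}_T)$; $\mathcal{W}_r(\mathbf{m}_T)=\mathrm{Adstat}^r({}_TP_S)\cap\mathcal{D}_r(\mathbf{m}_T)$; $\mathbb{V}_r(\mathbf{m}_T)=\mathcal{C}_I\cap\mathcal{D}_r(\mathbf{m}_T)$; $\mathbb{W}_r(\mathbf{m}_T)=\mathcal{L}_I\cap\mathcal{D}_r(\mathbf{m}_T)$; $\widehat{\mathcal{V}}_r(\mathbf{m}_T)=\mathcal{V}_r(\mathbf{m}_T)\cap\mathcal{L}_I$; $\widehat{\mathcal{W}}_r(\mathbf{m}_T)=\mathcal{W}_r(\mathbf{m}_T)\cap\mathcal{C}_I$; $\mathcal{X}_r(\mathbf{m}_T)=\mathcal{V}_r(\mathbf{m}_T)\cap\mathcal{W}_r(\mathbf{m}_T)$; $\mathbb{X}_r(\mathbf{m}_T)=\mathbb{V}_r(\mathbf{m}_T)\cap\mathbb{W}_r(\mathbf{m}_T)$; $\mathcal{X}_r^*(\mathbf{m}_T)=\{(U\otimes_TP)_S\mid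 U\in\mathcal{X}_r(\mathbf{m}_T)\}$; $\mathbb{X}_r^*(\mathbf{m}_T)=\{(U\otimes_TP)_S\mid U\in\mathbb{X}_r(\mathbf{m}_T)\}$. *)

(* Defs.v *)
From HB Require Import structures.
From mathcomp Require Import all_boot all_algebra generic_quotient ring_quotient.
From mathcomp Require Import freeg.
From mathcomp Require Import boolp.

Set Implicit Arguments.
Unset Strict Implicit.
Unset Printing Implicit Defensive.

Import GRing.Theory.
Local Open Scope ring_scope.
Local Open Scope quotient_scope.

(* A left T-module is an [lmodType T]; a right S-module is an [lmodType S^c],
   where [(s : S^c) *: k] stands for k s.  A (T,S)-bimodule M is an [lmodType T]
   with a commuting right action [m *> s]; [rmod M] is M as a right S-module.
   Rings are [pzRingType]s: associative and unital, possibly zero. *)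

Reserved Notation "m *> s" (at level 40, left associativity).

(* Classes of modules, with intersection and (extensional) equality.  They are
   not sets in the sense of classical_sets, because [set (lmodType R)] is a
   universe inconsistency. *)
Definition modClass (R : pzRingType) := lmodType R -> Prop.

Definition modClassI (R : pzRingType) (C D : modClass R) : modClass R :=
  fun M => C M /\ D M.

Definition modClass_eq (R : pzRingType) (C D : modClass R) : Prop :=
  forall M, C M <-> D M.

Infix "`&`" := modClassI (at level 48, left associativity) : modclass_scope.
Infix "=c" := modClass_eq (at level 70, no associativity) : modclass_scope.
Delimit Scope modclass_scope with MC.
Bind Scope modclass_scope with modClass.

HB.mixin Record Lmodule_isBimodule (T S : pzRingType) M of GRing.Lmodule T M := {
  actr : M -> S -> M;
  actrA : forall m a b, actr (actr m a) b = actr m (a * b);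
  actr1 : forall m, actr m 1 = m;
  actrDl : forall m n a, actr (m + n) a = actr m a + actr n a;
  actrDr : forall m a b, actr m (a + b) = actr m a + actr m b;
  actrZ : forall t m s, actr (t *: m) s = t *: actr m s
}.

#[short(type="bimodType")]
HB.structure Definition Bimodule (T S : pzRingType) :=
  {M of GRing.Lmodule T M & Lmodule_isBimodule T S M}.

Notation "m *> s" := (actr m s) : ring_scope.

Definition rmod (T S : pzRingType) (M : bimodType T S) : Type := M.

Section RightModule.
Variables (T S : pzRingType) (M : bimodType T S).

HB.instance Definition _ := GRing.Zmodule.on (rmod M).

Let racta (a b : S^c) (m : rmod M) :
  ((m : M) *> b) *> a = (m : M) *> (a * b : S^c).
Proof. exact: actrA. Qed.
Let ract1 (m : rmod M) : (m : M) *> (1 : S^c) = m.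
Proof. exact: actr1. Qed.
Let ractDr (a : S^c) (m n : rmod M) :
  ((m + n : rmod M) : M) *> a = (m : M) *> a + (n : M) *> a.
Proof. exact: actrDl. Qed.
Let ractDl (m : rmod M) (a b : S^c) :
  (m : M) *> (a + b) = (m : M) *> a + (m : M) *> b.
Proof. exact: actrDr. Qed.

HB.instance Definition _ := GRing.Zmodule_isLmodule.Build S^c (rmod M)
  (scale := fun (s : S^c) (m : rmod M) => (m : M) *> s)
  racta ract1 ractDr ractDl.

Lemma rmod_scaleE (s : S) (m : M) : (s : S^c) *: (m : rmod M) = m *> s.
Proof. by []. Qed.

End RightModule.

Section RegularBimodule.
Variable R : pzRingType.
Let regA (m : R^o) (a b : R) : (m * a) * b = m * (a * b) :> R.
Proof. by rewrite mulrA. Qed.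
Let reg1 (m : R^o) : m * 1 = m :> R. Proof. exact: mulr1. Qed.
Let regDl (m n : R^o) (a : R) : (m + n) * a = m * a + n * a :> R.
Proof. exact: mulrDl. Qed.
Let regDr (m : R^o) (a b : R) : m * (a + b) = m * a + m * b :> R.
Proof. exact: mulrDr. Qed.
Let regZ (t : R) (m : R^o) (s : R) : (t *: m) * s = t * (m * s) :> R.
Proof. by rewrite mulrA. Qed.
HB.instance Definition _ := Lmodule_isBimodule.Build R R R^o
  (actr := fun (m : R^o) (s : R) => m * s :> R) regA reg1 regDl regDr regZ.

Lemma reg_actrE (m : R^o) (s : R) : m *> s = m * s :> R.
Proof. by []. Qed.
End RegularBimodule.

Section Tensor.
Variables (R : pzRingType) (M : lmodType R^c) (N : lmodType R).

Notation F := {freeg (M * N)%type}.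
Notation gen m n := (<< (m, n) >> : F).

Inductive tens_relator : F -> Prop :=
| tens_relDl m m' n : tens_relator (gen (m + m') n - (gen m n + gen m' n))
| tens_relDr m n n' : tens_relator (gen m (n + n') - (gen m n + gen m n'))
| tens_relZ m (r : R) n : tens_relator (gen ((r : R^c) *: m) n - gen m (r *: n)).

Inductive tens_span : F -> Prop :=
| tens_span_rel x : tens_relator x -> tens_span x
| tens_span0 : tens_span 0
| tens_spanB x y : tens_span x -> tens_span y -> tens_span (x - y).

Definition tens_null : {pred F} := fun x => `[< tens_span x >].

Lemma tens_null_closed : zmod_closed tens_null.
Proof.
split=> [|x y]; first exact/asboolP/tens_span0.
by move=> /asboolP xN /asboolP yN; apply/asboolP/tens_spanB.
Qed.

HB.instance Definition _ := GRing.isZmodClosed.Build F tens_null tens_null_closed.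

Definition tens : Type := Quotient.quot tens_null.
HB.instance Definition _ := GRing.Zmodule.on tens.
HB.instance Definition _ := ZmodQuotient.on tens.

Definition pure (m : M) (n : N) : tens := \pi_tens (gen m n).

Lemma tens_eq0 (x : F) : tens_span x -> \pi_tens x = 0.
Proof.
move=> xN; rewrite -[RHS](raddf0 (\pi_tens)); apply/eqP.
by rewrite -Quotient.idealrBE subr0; apply/asboolP.
Qed.

Lemma pureDl m m' n : pure (m + m') n = pure m n + pure m' n.
Proof.
apply/eqP; rewrite -subr_eq0 -!raddfD -raddfB; apply/eqP/tens_eq0.
exact/tens_span_rel/tens_relDl.
Qed.

Lemma pureDr m n n' : pure m (n + n') = pure m n + pure m n'.
Proof.
apply/eqP; rewrite -subr_eq0 -!raddfD -raddfB; apply/eqP/tens_eq0.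
exact/tens_span_rel/tens_relDr.
Qed.

Lemma pureZ m (r : R) n : pure ((r : R^c) *: m) n = pure m (r *: n).
Proof.
apply/eqP; rewrite -subr_eq0 -raddfB; apply/eqP/tens_eq0.
exact/tens_span_rel/tens_relZ.
Qed.

Lemma tens_ind (P : tens -> Prop) :
  (forall m n, P (pure m n)) -> (forall x y, P x -> P y -> P (x - y)) ->
  forall x, P x.
Proof.
move=> Pp PB.
have P0 : P 0 by rewrite -(subrr (pure 0 0)); apply: PB.
have PN x : P x -> P (- x) by rewrite -sub0r; apply: PB.
have PD x y : P x -> P y -> P (x + y).
  by move=> Px Py; rewrite -[y]opprK; apply/PB/PN.
elim/quotW=> D; rewrite -[D]freeg_sumE raddf_sum /=.
apply: big_rec => // -[m n] x _ Px; apply: (PD) => //.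
set k := coeff _ _; have -> : << k *g (m, n) >> = << (m, n) >> *~ k :> F.
  by rewrite freegU_mulz intz.
rewrite raddfMz; have Ppn : P (pure m n) by [].
have Pn j : P (pure m n *+ j) by elim: j => // j IH; rewrite mulrS; apply: PD.
by case: k => j; [exact: Pn | rewrite NegzE mulrNz; exact/PN/Pn].
Qed.

Definition balanced (A : zmodType) (f : M -> N -> A) : Prop :=
  [/\ forall n, {morph f^~ n : m m' / m + m'},
      forall m, {morph f m : n n' / n + n'}
    & forall m (r : R) n, f ((r : R^c) *: m) n = f m (r *: n)].

Section Lift.
Variables (A : zmodType) (f : M -> N -> A) (fB : balanced f).

Definition freeg_lift (x : F) : A := fglift (fun p => f p.1 p.2 : zmodule A) x.

Let freeg_liftB : zmod_morphism freeg_lift.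
Proof. exact: (@lift_is_additive _ _ (zmodule A) (fun p => f p.1 p.2)). Qed.

HB.instance Definition _ := GRing.isZmodMorphism.Build F A freeg_lift freeg_liftB.

Let freeg_liftU m n : freeg_lift (gen m n) = f m n.
Proof. by rewrite /freeg_lift liftU scale1r. Qed.

Let freeg_lift_null x : tens_span x -> freeg_lift x = 0.
Proof.
have [fDl fDr fZ] := fB.
have {}fDl n m m' : f (m + m') n = f m n + f m' n by exact: fDl.
elim=> [{}x|| {}x y _ x0 _ y0]; last by rewrite raddfB /= x0 y0 subr0.
- case=> [m m' n|m n n'|m r n]; rewrite raddfB /=.
  + by rewrite raddfD /= !freeg_liftU fDl subrr.
  + by rewrite raddfD /= !freeg_liftU fDr subrr.
  + by rewrite !freeg_liftU fZ subrr.
- exact: raddf0.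
Qed.

Definition tens_lift (_ : balanced f) (x : tens) : A := freeg_lift (repr x).

Let tens_lift_pi x : tens_lift fB (\pi_tens x) = freeg_lift x.
Proof.
apply/eqP; rewrite -subr_eq0 -raddfB; apply/eqP/freeg_lift_null/asboolP.
by have := Quotient.idealrBE tens_null (repr (\pi_tens x)) x; rewrite reprK eqxx.
Qed.

Lemma tens_lift_is_zmod_morphism : zmod_morphism (tens_lift fB).
Proof.
elim/quotW=> x; elim/quotW=> y.
by rewrite -raddfB !tens_lift_pi raddfB.
Qed.

HB.instance Definition _ :=
  GRing.isZmodMorphism.Build tens A (tens_lift fB) tens_lift_is_zmod_morphism.

Lemma tens_liftE m n : tens_lift fB (pure m n) = f m n.
Proof. by rewrite tens_lift_pi freeg_liftU. Qed.

Lemma tens_lift_unique (g : {additive tens -> A}) :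
  (forall m n, g (pure m n) = f m n) -> g =1 tens_lift fB.
Proof.
move=> gE; elim/tens_ind=> [m n|x y IHx IHy]; first by rewrite gE tens_liftE.
by rewrite !raddfB /= IHx IHy.
Qed.

End Lift.
End Tensor.

Arguments tens {R} M N.

(* For a (T,R)-bimodule U, a left R-module N, a right R-module M and an
   (R,S)-bimodule V: the left T-module U (x)_R N, the right S-module M (x)_R V
   and the (T,S)-bimodule U (x)_R V.  They are aliases of [tens], so that each
   carries only its own module structure. *)
Section LeftTensor.
Variables (T R : pzRingType) (U : bimodType T R) (N : lmodType R).

Definition ltens : Type := tens (rmod U) N.
HB.instance Definition _ := GRing.Zmodule.on ltens.

Definition lpure (u : U) (n : N) : ltens := pure (u : rmod U) n.

Let lact (t : T) (u : rmod U) (n : N) : tens (rmod U) N :=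
  pure (t *: (u : U) : rmod U) n.

Let lact_balanced t : balanced (lact t).
Proof.
split=> [n u u'|u n n'|u r n]; rewrite /lact.
- by rewrite -pureDl; congr pure; exact: (@scalerDr T U).
- exact: pureDr.
- rewrite -pureZ; congr pure; rewrite /GRing.scale /=.
  by apply: esym; apply: actrZ.
Qed.

Definition ltens_scale (t : T) : ltens -> ltens := tens_lift (lact_balanced t).

Lemma ltens_scale_pure t u n : ltens_scale t (lpure u n) = lpure (t *: u) n.
Proof. exact: tens_liftE. Qed.

Let scaleB t : zmod_morphism (ltens_scale t).
Proof. exact: tens_lift_is_zmod_morphism. Qed.

HB.instance Definition _ t :=
  GRing.isZmodMorphism.Build ltens ltens (ltens_scale t) (scaleB t).

Let scaleA a b x : ltens_scale a (ltens_scale b x) = ltens_scale (a * b) x.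
Proof.
elim/tens_ind: x => [u n|x y IHx IHy]; last by rewrite !raddfB /= IHx IHy.
by rewrite -[pure u n]/(lpure u n) !ltens_scale_pure scalerA.
Qed.
Let scale1 x : ltens_scale 1 x = x.
Proof.
elim/tens_ind: x => [u n|x y IHx IHy]; last by rewrite !raddfB /= IHx IHy.
by rewrite -[pure u n]/(lpure u n) !ltens_scale_pure scale1r.
Qed.
Let scaleDr t : {morph ltens_scale t : x y / x + y}.
Proof. exact: raddfD. Qed.
Let scaleDl x : {morph ltens_scale^~ x : a b / a + b}.
Proof.
move=> a b; elim/tens_ind: x => [u n|x y IHx IHy].
  rewrite -[pure u n]/(lpure u n) !ltens_scale_pure scalerDl.
  exact: (@pureDl _ (rmod U)).
by rewrite !raddfB /= IHx IHy opprD addrACA.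
Qed.

HB.instance Definition _ := GRing.Zmodule_isLmodule.Build T ltens
  scaleA scale1 scaleDr scaleDl.

Lemma ltens_scaleE t u n : t *: lpure u n = lpure (t *: u) n.
Proof. exact: ltens_scale_pure. Qed.

End LeftTensor.

Section RightTensor.
Variables (R S : pzRingType) (M : lmodType R^c) (V : bimodType R S).

Definition rtens : Type := tens M V.
HB.instance Definition _ := GRing.Zmodule.on rtens.

Definition rpure (m : M) (v : V) : rtens := pure m v.

Let ract (s : S) (m : M) (v : V) : tens M V := pure m (v *> s).

Let ract_balanced s : balanced (ract s).
Proof.
split=> [v m m'|m v v'|m r v]; rewrite /ract.
- exact: pureDl.
- by rewrite actrDl pureDr.
- by rewrite pureZ actrZ.
Qed.

Definition rtens_scale (s : S^c) : rtens -> rtens := tens_lift (ract_balanced s).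

Lemma rtens_scale_pure (s : S^c) m v : rtens_scale s (rpure m v) = rpure m (v *> s).
Proof. exact: tens_liftE. Qed.

Let scaleB s : zmod_morphism (rtens_scale s).
Proof. exact: tens_lift_is_zmod_morphism. Qed.

HB.instance Definition _ s :=
  GRing.isZmodMorphism.Build rtens rtens (rtens_scale s) (scaleB s).

Let scaleA (a b : S^c) x : rtens_scale a (rtens_scale b x) = rtens_scale (a * b) x.
Proof.
elim/tens_ind: x => [m v|x y IHx IHy]; last by rewrite !raddfB /= IHx IHy.
by rewrite -[pure m v]/(rpure m v) !rtens_scale_pure actrA.
Qed.
Let scale1 x : rtens_scale 1 x = x.
Proof.
elim/tens_ind: x => [m v|x y IHx IHy]; last by rewrite !raddfB /= IHx IHy.
by rewrite -[pure m v]/(rpure m v) !rtens_scale_pure actr1.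
Qed.
Let scaleDr s : {morph rtens_scale s : x y / x + y}.
Proof. exact: raddfD. Qed.
Let scaleDl x : {morph rtens_scale^~ x : a b / a + b}.
Proof.
move=> a b; elim/tens_ind: x => [m v|x y IHx IHy].
  by rewrite -[pure m v]/(rpure m v) !rtens_scale_pure actrDr; apply: pureDr.
by rewrite !raddfB /= IHx IHy opprD addrACA.
Qed.

HB.instance Definition _ := GRing.Zmodule_isLmodule.Build S^c rtens
  scaleA scale1 scaleDr scaleDl.

Lemma rtens_scaleE (s : S) m v : (s : S^c) *: rpure m v = rpure m (v *> s).
Proof. exact: rtens_scale_pure. Qed.

End RightTensor.

Section BimoduleTensor.
Variables (T R S : pzRingType) (U : bimodType T R) (V : bimodType R S).

Definition btens : Type := tens (rmod U) V.
HB.instance Definition _ := GRing.Lmodule.copy btens (ltens U V).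

Definition bpure (u : U) (v : V) : btens := pure (u : rmod U) v.

Definition btens_actr (x : btens) (s : S) : btens :=
  (s : S^c) *: (x : rtens (rmod U) V).

Let bactA x a b : btens_actr (btens_actr x a) b = btens_actr x (a * b).
Proof. exact: (@scalerA _ (rtens (rmod U) V)). Qed.
Let bact1 x : btens_actr x 1 = x.
Proof. exact: (@scale1r _ (rtens (rmod U) V)). Qed.
Let bactDl x y a : btens_actr (x + y) a = btens_actr x a + btens_actr y a.
Proof. exact: (@scalerDr _ (rtens (rmod U) V)). Qed.
Let bactDr x a b : btens_actr x (a + b) = btens_actr x a + btens_actr x b.
Proof. exact: (@scalerDl _ (rtens (rmod U) V)). Qed.
Let bactZ (t : T) x s : btens_actr (t *: x) s = t *: btens_actr x s.
Proof.
elim/tens_ind: x => [u v|x y IHx IHy]; last first.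
  have actB a b : btens_actr (a - b) s = btens_actr a s - btens_actr b s.
    exact: (@scalerBr _ (rtens (rmod U) V)).
  by rewrite scalerBr !actB scalerBr IHx IHy.
rewrite -[pure u v]/(lpure u v).
rewrite -[btens_actr (lpure u v) s]/((s : S^c) *: rpure (u : rmod U) v).
rewrite rtens_scaleE -[rpure _ _]/(lpure u (v *> s)).
have E (w : V) : t *: (lpure u w : btens) = lpure (t *: u) w.
  exact: ltens_scaleE.
rewrite !E; exact: (rtens_scaleE s (t *: u : rmod U) v).
Qed.

HB.instance Definition _ := Lmodule_isBimodule.Build T S btens
  bactA bact1 bactDl bactDr bactZ.

Lemma btens_scaleE (t : T) u v : t *: bpure u v = bpure (t *: u) v.
Proof. exact: (@ltens_scaleE _ _ U V). Qed.

Lemma btens_actrE u v (s : S) : bpure u v *> s = bpure u (v *> s).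
Proof. exact: (@rtens_scaleE _ _ (rmod U) V). Qed.

End BimoduleTensor.

Section HomZmodule.
Variables (R : pzRingType) (U K : lmodType R).

Definition hom : Type := {linear U -> K}.
HB.instance Definition _ := gen_eqMixin hom.
HB.instance Definition _ := gen_choiceMixin hom.

Definition hom_fun (f : hom) : U -> K := (f : {linear U -> K}).
Coercion hom_fun : hom >-> Funclass.
HB.instance Definition _ (f : hom) :=
  GRing.Linear.copy (hom_fun f) (f : {linear U -> K}).

Lemma homP (f g : hom) : (forall u, f u = g u) -> f = g.
Proof.
case: f g => [f [fD fZ]] [g [gD gZ]] /= fg.
have {}fg : f = g by apply/funext.
case: _ / fg in gD gZ *; congr (GRing.Linear.Pack (GRing.Linear.Class _ _)).
- by case: fD gD => [fD] [gD]; congr Algebra.isNmodMorphism.Axioms_; apply: Prop_irrelevance.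
- by case: fZ gZ => [fZ] [gZ]; congr GRing.isScalable.Axioms_; apply: Prop_irrelevance.
Qed.

Definition hom0 : hom := (\0 : U -> K) : {linear U -> K}.
Definition hom_opp (f : hom) : hom := (\- f : U -> K) : {linear U -> K}.
Definition hom_add (f g : hom) : hom := (f \+ g : U -> K) : {linear U -> K}.

Let addA : associative hom_add.
Proof. by move=> f g h; apply: homP => u; apply: addrA. Qed.
Let addC : commutative hom_add.
Proof. by move=> f g; apply: homP => u; apply: addrC. Qed.
Let add0 : left_id hom0 hom_add.
Proof. by move=> f; apply: homP => u; apply: add0r. Qed.
Let addN : left_inverse hom0 hom_opp hom_add.
Proof. by move=> f; apply: homP => u; apply: addNr. Qed.

HB.instance Definition _ := GRing.isZmodule.Build hom addA addC add0 addN.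

Lemma homDE (f g : hom) u : (f + g) u = f u + g u. Proof. by []. Qed.

End HomZmodule.

(* For a (T,S)-bimodule U: Hom_{T-}(U, K) as a left S-module, (s f)(u) = f(u s),
   and Hom_{-S}(U, K) as a right T-module, (f t)(u) = f(t u). *)
Section LeftHom.
Variables (T S : pzRingType) (U : bimodType T S) (K : lmodType T).

Definition lhom : Type := hom U K.
HB.instance Definition _ := GRing.Zmodule.on lhom.

Definition lhom_fun (f : lhom) : U -> K := (f : hom U K).
Coercion lhom_fun : lhom >-> Funclass.
HB.instance Definition _ (f : lhom) := GRing.Linear.copy (lhom_fun f) (f : hom U K).

Definition lhom_scale_fun (s : S) (f : lhom) (u : U) : K := f (u *> s).

Let lhom_scale_linear s f : linear (lhom_scale_fun s f).
Proof. by move=> t u v; rewrite /lhom_scale_fun actrDl actrZ linearP. Qed.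

HB.instance Definition _ s f :=
  GRing.isLinear.Build T U K *:%R (lhom_scale_fun s f) (lhom_scale_linear s f).

Definition lhom_scale (s : S) (f : lhom) : lhom :=
  lhom_scale_fun s f : {linear U -> K}.

Let scaleA a b f : lhom_scale a (lhom_scale b f) = lhom_scale (a * b) f.
Proof.
by apply: homP => u; rewrite -[RHS]/(f (u *> (a * b))) -actrA.
Qed.
Let scale1 f : lhom_scale 1 f = f.
Proof. by apply: homP => u; rewrite -[LHS]/(f (u *> 1)) actr1. Qed.
Let scaleDr : right_distributive lhom_scale +%R.
Proof. by move=> s f g; apply: homP. Qed.
Let scaleDl f : {morph lhom_scale^~ f : a b / a + b}.
Proof.
by move=> a b; apply: homP => u; rewrite -[LHS]/(f (u *> (a + b))) actrDr linearD.
Qed.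

HB.instance Definition _ := GRing.Zmodule_isLmodule.Build S lhom
  scaleA scale1 scaleDr scaleDl.

Lemma lhom_scaleE (s : S) (f : lhom) u : (s *: f) u = f (u *> s).
Proof. by []. Qed.

End LeftHom.

Section RightHom.
Variables (T S : pzRingType) (U : bimodType T S) (K : lmodType S^c).

Definition rhom : Type := hom (rmod U) K.
HB.instance Definition _ := GRing.Zmodule.on rhom.

Definition rhom_fun (f : rhom) : rmod U -> K := (f : hom (rmod U) K).
Coercion rhom_fun : rhom >-> Funclass.
HB.instance Definition _ (f : rhom) :=
  GRing.Linear.copy (rhom_fun f) (f : hom (rmod U) K).

Definition rhom_scale_fun (t : T^c) (f : rhom) (u : rmod U) : K :=
  f ((t : T) *: (u : U)).

Let rhom_scale_linear t f : linear (rhom_scale_fun t f).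
Proof.
move=> s u v; rewrite /rhom_scale_fun -linearP; congr (f _).
by rewrite -[s *: u]/((u : U) *> s) [LHS](@scalerDr T U) -actrZ.
Qed.

HB.instance Definition _ t f := GRing.isLinear.Build S^c (rmod U) K *:%R
  (rhom_scale_fun t f) (rhom_scale_linear t f).

Definition rhom_scale (t : T^c) (f : rhom) : rhom :=
  rhom_scale_fun t f : {linear rmod U -> K}.

Let scaleA a b f : rhom_scale a (rhom_scale b f) = rhom_scale (a * b) f.
Proof.
apply: homP => u; rewrite -[LHS]/(f ((b : T) *: ((a : T) *: (u : U)))).
by rewrite scalerA.
Qed.
Let scale1 f : rhom_scale 1 f = f.
Proof. by apply: homP => u; rewrite -[LHS]/(f ((1 : T) *: (u : U))) scale1r. Qed.
Let scaleDr : right_distributive rhom_scale +%R.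
Proof. by move=> t f g; apply: homP. Qed.
Let scaleDl f : {morph rhom_scale^~ f : a b / a + b}.
Proof.
move=> a b; apply: homP => u.
rewrite -[LHS]/(f (((a : T) + (b : T)) *: (u : U))) scalerDl.
exact: (linearD (f : hom (rmod U) K)).
Qed.

HB.instance Definition _ := GRing.Zmodule_isLmodule.Build T^c rhom
  scaleA scale1 scaleDr scaleDl.

Lemma rhom_scaleE (t : T) (f : rhom) (u : U) :
  ((t : T^c) *: f) u = f (t *: u : rmod U).
Proof. by []. Qed.

End RightHom.

Lemma ltens_linear (T R : pzRingType) (U : bimodType T R) (N : lmodType R)
    (A : lmodType T) (f : rmod U -> N -> A) (fB : balanced f) :
  (forall t (u : U) n, f (t *: u) n = t *: f u n) ->
  linear (tens_lift fB : ltens U N -> A).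
Proof.
move=> fZ t x y; rewrite (raddfD (tens_lift fB)) /=; congr (_ + _).
elim/tens_ind: x => [u n|a b IHa IHb].
  rewrite -[pure u n]/(lpure u n) ltens_scaleE.
  by rewrite [LHS]tens_liftE fZ; congr (_ *: _); apply: esym; apply: tens_liftE.
by rewrite scalerBr !(raddfB (tens_lift fB)) /= IHa IHb scalerBr.
Qed.

Lemma rtens_linear (R S : pzRingType) (M : lmodType R^c) (V : bimodType R S)
    (A : lmodType S^c) (f : M -> V -> A) (fB : balanced f) :
  (forall m (v : V) (s : S), f m (v *> s) = (s : S^c) *: f m v) ->
  linear (tens_lift fB : rtens M V -> A).
Proof.
move=> fZ s x y; rewrite (raddfD (tens_lift fB)) /=; congr (_ + _).
elim/tens_ind: x => [m v|a b IHa IHb].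
  rewrite -[pure m v]/(rpure m v) (rtens_scaleE (s : S)).
  by rewrite [LHS]tens_liftE fZ; congr (_ *: _); apply: esym; apply: tens_liftE.
by rewrite scalerBr !(raddfB (tens_lift fB)) /= IHa IHb scalerBr.
Qed.

Section LeftStatic.
Variables (T S : pzRingType) (U : bimodType T S).

Section Eval.
Variable K : lmodType T.

Let ev (u : rmod U) (f : lhom U K) : K := f (u : U).

Let ev_balanced : balanced ev.
Proof. by split=> // f; apply: (linearD (f : hom U K)). Qed.

Definition eval_l : ltens U (lhom U K) -> K := tens_lift ev_balanced.

Let eval_l_linear : linear eval_l.
Proof. by apply: ltens_linear => t u f; apply: (linearZZ (f : hom U K)). Qed.

HB.instance Definition _ :=
  GRing.isLinear.Build T (ltens U (lhom U K)) K *:%R eval_l eval_l_linear.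

Lemma eval_lE u f : eval_l (lpure u f) = f u.
Proof. exact: tens_liftE. Qed.
End Eval.

Section Coeval.
Variable L : lmodType S.

Definition coeval_l_fun (l : L) (u : U) : ltens U L := lpure u l.

Let coeval_l_fun_linear l : linear (coeval_l_fun l).
Proof.
move=> t u v; rewrite /coeval_l_fun ltens_scaleE.
exact: (@pureDl _ (rmod U)).
Qed.

HB.instance Definition _ l := GRing.isLinear.Build T U (ltens U L) *:%R
  (coeval_l_fun l) (coeval_l_fun_linear l).

Definition coeval_l (l : L) : lhom U (ltens U L) :=
  coeval_l_fun l : {linear U -> ltens U L}.

Let coeval_l_linear : linear coeval_l.
Proof.
move=> s l l'; apply: homP => u.
rewrite -[LHS]/(lpure u (s *: l + l')).
rewrite -[RHS]/(lpure (u *> s) l + lpure u l').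
by rewrite /lpure -rmod_scaleE pureZ pureDr.
Qed.

HB.instance Definition _ :=
  GRing.isLinear.Build S L (lhom U (ltens U L)) *:%R coeval_l coeval_l_linear.

Lemma coeval_lE l u : coeval_l l u = lpure u l.
Proof. by []. Qed.
End Coeval.

Definition Stat_l : modClass T := fun K => bijective (@eval_l K).
Definition Adstat_l : modClass S := fun L => bijective (@coeval_l L).

End LeftStatic.

Section RightStatic.
Variables (T S : pzRingType) (U : bimodType T S).

Section Eval.
Variable K : lmodType S^c.

Let ev (f : rhom U K) (u : U) : K := f (u : rmod U).

Let ev_balanced : balanced ev.
Proof. by split=> // f; apply: (linearD (f : hom (rmod U) K)). Qed.

Definition eval_r : rtens (rhom U K) U -> K := tens_lift ev_balanced.

Let eval_r_linear : linear eval_r.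
Proof.
by apply: rtens_linear => f u s; apply: (linearZZ (f : hom (rmod U) K)).
Qed.

HB.instance Definition _ := GRing.isLinear.Build S^c (rtens (rhom U K) U) K *:%R
  eval_r eval_r_linear.

Lemma eval_rE f (u : U) : eval_r (rpure f u) = f (u : rmod U).
Proof. exact: tens_liftE. Qed.
End Eval.

Section Coeval.
Variable L : lmodType T^c.

Definition coeval_r_fun (l : L) (u : rmod U) : rtens L U := rpure l (u : U).

Let coeval_r_fun_linear l : linear (coeval_r_fun l).
Proof.
by move=> s u v; rewrite /coeval_r_fun (rtens_scaleE (s : S)); apply: pureDr.
Qed.

HB.instance Definition _ l := GRing.isLinear.Build S^c (rmod U) (rtens L U) *:%R
  (coeval_r_fun l) (coeval_r_fun_linear l).

Definition coeval_r (l : L) : rhom U (rtens L U) :=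
  coeval_r_fun l : {linear rmod U -> rtens L U}.

Let coeval_r_linear : linear coeval_r.
Proof.
move=> t l l'; apply: homP => u.
rewrite -[LHS]/(rpure (t *: l + l') (u : U)).
rewrite -[RHS]/(rpure l ((t : T) *: (u : U)) + rpure l' (u : U)).
by rewrite /rpure -pureZ pureDl.
Qed.

HB.instance Definition _ := GRing.isLinear.Build T^c L (rhom U (rtens L U)) *:%R
  coeval_r coeval_r_linear.

Lemma coeval_rE l (u : U) : coeval_r l (u : rmod U) = rpure l u.
Proof. by []. Qed.
End Coeval.

Definition Stat_r : modClass S^c := fun K => bijective (@eval_r K).
Definition Adstat_r : modClass T^c := fun L => bijective (@coeval_r L).

End RightStatic.

(* Unital Morita semi-contexts (T, S, P, Q, <,>_T, I); the ideal I is not a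
   field but the image of the pairing, see [trace_ideal]. *)
Record moritaSemiContext (T S : pzRingType) (P : bimodType T S)
    (Q : bimodType S T) := MoritaSemiContext {
  pairing :> {linear btens P Q -> T^o};
  pairing_actr : forall x t, pairing (x *> t) = pairing x *> t
}.

Definition injective_context (T S : pzRingType) (P : bimodType T S)
  (Q : bimodType S T) (m : moritaSemiContext P Q) : Prop := injective m.

Section SemiContext.
Variables (T S : pzRingType) (P : bimodType T S) (Q : bimodType S T).
Variable m : moritaSemiContext P Q.

Definition bracket (p : P) (q : Q) : T := m (bpure p q).

Lemma bracketZl t p q : bracket (t *: p) q = t * bracket p q.
Proof. by rewrite /bracket -btens_scaleE linearZ. Qed.
Lemma bracketZr p q t : bracket p (q *> t) = bracket p q * t.
Proof. by rewrite /bracket -btens_actrE pairing_actr. Qed.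
Lemma bracketM p s q : bracket (p *> s) q = bracket p (s *: q).
Proof. by congr (m _); apply: (@pureZ _ (rmod P)). Qed.
Lemma bracketDl q : {morph bracket^~ q : p p' / p + p'}.
Proof.
move=> p p'; rewrite /bracket -linearD; congr (m _).
exact: (@pureDl _ (rmod P)).
Qed.
Lemma bracketDr p : {morph bracket p : q q' / q + q'}.
Proof.
move=> q q'; rewrite /bracket -linearD; congr (m _).
exact: (@pureDr _ (rmod P)).
Qed.

Definition in_trace : {pred T^o} := fun t => `[< exists x, m x = t >].

Lemma in_trace_submod : submod_closed in_trace.
Proof.
split=> [|t x y]; first by apply/asboolP; exists 0; rewrite linear0.
move=> /asboolP[a <-] /asboolP[b <-]; apply/asboolP.
by exists (t *: a + b); rewrite linearP.
Qed.

HB.instance Definition _ := GRing.isSubmodClosed.Build T T^o in_trace in_trace_submod.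

Record trace_ideal := TraceIdeal {
  trace_sub : T^o;
  trace_subP : trace_sub \in in_trace
}.
HB.instance Definition _ := [isSub for trace_sub].
HB.instance Definition _ := [Choice of trace_ideal by <:].
HB.instance Definition _ := [SubChoice_isSubLmodule of trace_ideal by <:].

Definition trace_val (x : trace_ideal) : T := trace_sub x.

Fact trace_actr_subproof (x : trace_ideal) (t : T) : trace_sub x *> t \in in_trace.
Proof.
have /asboolP[a <-] := trace_subP x; apply/asboolP.
by exists (a *> t); rewrite pairing_actr.
Qed.

Definition trace_actr (x : trace_ideal) (t : T) : trace_ideal :=
  TraceIdeal (trace_actr_subproof x t).

Let tractA x a b : trace_actr (trace_actr x a) b = trace_actr x (a * b).
Proof. by apply: val_inj; apply: actrA. Qed.
Let tract1 x : trace_actr x 1 = x.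
Proof. by apply: val_inj; apply: actr1. Qed.
Let tractDl x y a : trace_actr (x + y) a = trace_actr x a + trace_actr y a.
Proof. by apply: val_inj; apply: actrDl. Qed.
Let tractDr x a b : trace_actr x (a + b) = trace_actr x a + trace_actr x b.
Proof. by apply: val_inj; apply: actrDr. Qed.
Let tractZ (t : T) x s : trace_actr (t *: x) s = t *: trace_actr x s.
Proof. by apply: val_inj; apply: actrZ. Qed.

HB.instance Definition _ := Lmodule_isBimodule.Build T T trace_ideal
  tractA tract1 tractDl tractDr tractZ.

Lemma trace_scaleE (t : T) (x : trace_ideal) : trace_val (t *: x) = t * trace_val x.
Proof. by []. Qed.
Lemma trace_actrE (x : trace_ideal) (t : T) : trace_val (x *> t) = trace_val x * t.
Proof. by []. Qed.

Notation I := trace_ideal.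

Section LeftModules.
Variable U : lmodType T.

Let mul (t : rmod I) (u : U) : U := trace_val (t : I) *: u.

Let mul_balanced : balanced mul.
Proof.
split=> [u x y|x u v|x t u].
- exact: (scalerDl u (trace_val (x : I)) (trace_val (y : I))).
- exact: scalerDr.
- by rewrite /mul scalerA.
Qed.

Definition mul_l : ltens I U -> U := tens_lift mul_balanced.

Let mul_l_linear : linear mul_l.
Proof. by apply: ltens_linear => t x u; rewrite /mul scalerA. Qed.

HB.instance Definition _ :=
  GRing.isLinear.Build T (ltens I U) U *:%R mul_l mul_l_linear.

Lemma mul_lE (t : I) u : mul_l (lpure t u) = trace_val t *: u.
Proof. exact: tens_liftE. Qed.

Definition act_l_fun (u : U) (t : I) : U := trace_val t *: u.

Let act_l_fun_linear u : linear (act_l_fun u).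
Proof.
move=> a x y; rewrite /act_l_fun scalerA -scalerDl; congr (_ *: _).
Qed.

HB.instance Definition _ u :=
  GRing.isLinear.Build T I U *:%R (act_l_fun u) (act_l_fun_linear u).

Definition act_l (u : U) : lhom I U := act_l_fun u : {linear I -> U}.

Let act_l_linear : linear act_l.
Proof.
move=> a u v; apply: homP => t.
rewrite -[LHS]/(trace_val t *: (a *: u + v)).
rewrite -[RHS]/((trace_val t * a) *: u + trace_val t *: v).
by rewrite scalerDr scalerA.
Qed.

HB.instance Definition _ :=
  GRing.isLinear.Build T U (lhom I U) *:%R act_l act_l_linear.

Lemma act_lE u (t : I) : act_l u t = trace_val t *: u.
Proof. by []. Qed.

Definition delta_l_fun (q : rmod Q) (u : U) (p : P) : U := bracket p (q : Q) *: u.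

Let delta_l_fun_linear q u : linear (delta_l_fun q u).
Proof.
by move=> t p p'; rewrite /delta_l_fun bracketDl bracketZl scalerDl scalerA.
Qed.

HB.instance Definition _ q u :=
  GRing.isLinear.Build T P U *:%R (delta_l_fun q u) (delta_l_fun_linear q u).

Let delta (q : rmod Q) (u : U) : lhom P U := delta_l_fun q u : {linear P -> U}.

Let delta_balanced : balanced delta.
Proof.
split=> [u q q'|q u u'|q t u]; apply: homP => p.
- rewrite -[LHS]/(bracket p ((q : Q) + (q' : Q)) *: u) bracketDr scalerDl.
  by [].
- exact: scalerDr.
- rewrite -[LHS]/(bracket p ((q : Q) *> t) *: u) bracketZr -scalerA.
  by [].
Qed.

Definition delta_l : ltens Q U -> lhom P U := tens_lift delta_balanced.

Let delta_l_linear : linear delta_l.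
Proof.
apply: ltens_linear => s q u; apply: homP => p.
by rewrite -[LHS]/(bracket p (s *: (q : Q)) *: u) -bracketM.
Qed.

HB.instance Definition _ :=
  GRing.isLinear.Build S (ltens Q U) (lhom P U) *:%R delta_l delta_l_linear.

Lemma delta_lE (q : Q) u p : delta_l (lpure q u) p = bracket p q *: u.
Proof. by rewrite [delta_l _]tens_liftE. Qed.

End LeftModules.

Section RightModules.
Variable U : lmodType T^c.

Let mul (u : U) (t : I) : U := (trace_val t : T^c) *: u.

Let mul_balanced : balanced mul.
Proof.
split=> [t u v|u x y|u t x].
- exact: scalerDr.
- exact: (scalerDl u (trace_val x : T^c) (trace_val y : T^c)).
- by rewrite /mul scalerA.
Qed.

Definition mul_r : rtens U I -> U := tens_lift mul_balanced.

Let mul_r_linear : linear mul_r.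
Proof. by apply: rtens_linear => u x t; rewrite /mul scalerA. Qed.

HB.instance Definition _ :=
  GRing.isLinear.Build T^c (rtens U I) U *:%R mul_r mul_r_linear.

Lemma mul_rE u (t : I) : mul_r (rpure u t) = (trace_val t : T^c) *: u.
Proof. exact: tens_liftE. Qed.

Definition act_r_fun (u : U) (t : rmod I) : U := (trace_val (t : I) : T^c) *: u.

Let act_r_fun_linear u : linear (act_r_fun u).
Proof.
move=> a x y; rewrite /act_r_fun scalerA -scalerDl; congr (_ *: _).
Qed.

HB.instance Definition _ u :=
  GRing.isLinear.Build T^c (rmod I) U *:%R (act_r_fun u) (act_r_fun_linear u).

Definition act_r (u : U) : rhom I U := act_r_fun u : {linear rmod I -> U}.

Let act_r_linear : linear act_r.
Proof.
move=> a u v; apply: homP => t.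
rewrite -[LHS]/((trace_val (t : I) : T^c) *: (a *: u + v)).
rewrite -[RHS]/(((trace_val (t : I) : T^c) * a) *: u + (trace_val (t : I) : T^c) *: v).
by rewrite scalerDr scalerA.
Qed.

HB.instance Definition _ :=
  GRing.isLinear.Build T^c U (rhom I U) *:%R act_r act_r_linear.

Lemma act_rE u (t : I) : act_r u (t : rmod I) = (trace_val t : T^c) *: u.
Proof. by []. Qed.

Definition delta_r_fun (u : U) (p : P) (q : rmod Q) : U :=
  (bracket p (q : Q) : T^c) *: u.

Let delta_r_fun_linear u p : linear (delta_r_fun u p).
Proof.
move=> t q q'; rewrite /delta_r_fun scalerA.
rewrite -[t *: q + q']/(((q : Q) *> t) + (q' : Q)) bracketDr bracketZr.
exact: (scalerDl u).
Qed.

HB.instance Definition _ u p := GRing.isLinear.Build T^c (rmod Q) U *:%R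
  (delta_r_fun u p) (delta_r_fun_linear u p).

Let delta (u : U) (p : P) : rhom Q U := delta_r_fun u p : {linear rmod Q -> U}.

Let delta_balanced : balanced delta.
Proof.
split=> [p u u'|u p p'|u t p]; apply: homP => q.
- exact: scalerDr.
- rewrite -[LHS]/((bracket (p + p') (q : Q) : T^c) *: u) bracketDl.
  exact: (scalerDl u).
- rewrite -[RHS]/((bracket (t *: p) (q : Q) : T^c) *: u) bracketZl.
  exact: (@scalerA T^c U).
Qed.

Definition delta_r : rtens U P -> rhom Q U := tens_lift delta_balanced.

Let delta_r_linear : linear delta_r.
Proof.
apply: rtens_linear => u p s; apply: homP => q.
by rewrite -[LHS]/((bracket (p *> s) (q : Q) : T^c) *: u) bracketM.
Qed.

HB.instance Definition _ :=
  GRing.isLinear.Build S^c (rtens U P) (rhom Q U) *:%R delta_r delta_r_linear.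

Lemma delta_rE u p (q : Q) :
  delta_r (rpure u p) (q : rmod Q) = (bracket p q : T^c) *: u.
Proof. by rewrite [delta_r _]tens_liftE. Qed.

End RightModules.

Local Open Scope modclass_scope.

(* C_l, L_l and C_r, L_r are the classes {_I}C, {_I}L and C_I, L_I.  The
   prefixes cal, bb and hat stand for the calligraphic, blackboard and hatted
   letters.  The canonical maps are module homomorphisms ([{linear _ -> _}]), so
   being an isomorphism is being bijective. *)
Definition C_l : modClass T := fun U => bijective (@mul_l U).
Definition L_l : modClass T := fun U => bijective (@act_l U).
Definition D_l : modClass T := fun U => bijective (@delta_l U).

Definition calV_l : modClass T := Stat_l P `&` D_l.
Definition calW_l : modClass T := Adstat_l Q `&` D_l.
Definition bbV_l : modClass T := C_l `&` D_l.
Definition bbW_l : modClass T := L_l `&` D_l.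
Definition hatV_l : modClass T := calV_l `&` L_l.
Definition hatW_l : modClass T := calW_l `&` C_l.
Definition calX_l : modClass T := calV_l `&` calW_l.
Definition bbX_l : modClass T := bbV_l `&` bbW_l.
(* As for classes given by {F(U) | U in X}, membership is literal equality of
   modules; the class is not closed under isomorphism. *)
Definition calXstar_l : modClass S :=
  fun L => exists2 U : lmodType T, calX_l U & L = ltens Q U :> lmodType S.
Definition bbXstar_l : modClass S :=
  fun L => exists2 U : lmodType T, bbX_l U & L = ltens Q U :> lmodType S.

Definition C_r : modClass T^c := fun U => bijective (@mul_r U).
Definition L_r : modClass T^c := fun U => bijective (@act_r U).
Definition D_r : modClass T^c := fun U => bijective (@delta_r U).

Definition calV_r : modClass T^c := Stat_r Q `&` D_r.
Definition calW_r : modClass T^c := Adstat_r P `&` D_r.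
Definition bbV_r : modClass T^c := C_r `&` D_r.
Definition bbW_r : modClass T^c := L_r `&` D_r.
Definition hatV_r : modClass T^c := calV_r `&` L_r.
Definition hatW_r : modClass T^c := calW_r `&` C_r.
Definition calX_r : modClass T^c := calV_r `&` calW_r.
Definition bbX_r : modClass T^c := bbV_r `&` bbW_r.
Definition calXstar_r : modClass S^c :=
  fun L => exists2 U : lmodType T^c, calX_r U & L = rtens U P :> lmodType S^c.
Definition bbXstar_r : modClass S^c :=
  fun L => exists2 U : lmodType T^c, bbX_r U & L = rtens U P :> lmodType S^c.

End SemiContext.

(* Main.v *)
(* If the pairing is injective, it identifies P (x)_S Q with I as a
   (T,T)-bimodule.  For U in D_l, delta : Q (x)_T U -> Hom(P, U) is bijective,
   and modulo bijections each condition becomes the other: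
   - I (x)_T U = P (x)_S (Q (x)_T U) = P (x)_S Hom_T(P, U) carries the
     multiplication map to the evaluation map (associativity of (x));
   - Hom_T(I, U) = Hom_S(Q, Hom_T(P, U)) = Hom_S(Q, Q (x)_T U) carries
     u |-> [t |-> t u] to u |-> [q |-> q (x) u] (tensor-hom adjunction).
   The right-hand case is symmetric. *)
Require Import Defs.
From HB Require Import structures.
From mathcomp Require Import all_boot all_algebra.
From mathcomp Require Import boolp.

Set Implicit Arguments.
Unset Strict Implicit.
Unset Printing Implicit Defensive.

Import GRing.Theory.
Local Open Scope ring_scope.
Local Open Scope modclass_scope.

(** * Transfer of bijectivity along commuting squares *)

(** The square gives [h] as [k] composed with [g] and the inverse of [f], and symmetrically for [k].
    This is the shape of the Stat comparison: [h] becomes multiplication by the ideal and [k]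
    evaluation, with common target [U]. *)
Lemma bij_square_right (A B C D : Type) (f : A -> B) (g : A -> C)
    (h : B -> D) (k : C -> D) :
  bijective f -> bijective g -> (forall x, h (f x) = k (g x)) ->
  bijective h <-> bijective k.
Proof.
move=> [f' fK f'K] [g' gK g'K] hf; split=> kB.
  apply: (eq_bij (bij_comp kB (bij_comp (Bijective fK f'K) (Bijective g'K gK)))).
  by move=> x /=; rewrite hf g'K.
apply: (eq_bij (bij_comp kB (bij_comp (Bijective gK g'K) (Bijective f'K fK)))).
by move=> x /=; rewrite -hf f'K.
Qed.

(** The dual shape, for the Adstat comparison: [h] and [k] become the two canonical maps out of [U]
    into Hom modules. *)
Lemma bij_square_left (A B C D : Type) (f : B -> D) (g : C -> D)
    (h : A -> B) (k : A -> C) :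
  bijective f -> bijective g -> (forall x, f (h x) = g (k x)) ->
  bijective h <-> bijective k.
Proof.
move=> [f' fK f'K] [g' gK g'K] fh; split=> hB.
  apply: (eq_bij (bij_comp (bij_comp (Bijective g'K gK) (Bijective fK f'K)) hB)).
  by move=> x /=; rewrite fh gK.
apply: (eq_bij (bij_comp (bij_comp (Bijective f'K fK) (Bijective gK g'K)) hB)).
by move=> x /=; rewrite -fh fK.
Qed.

Lemma inj_surj_bij (A : Type) (B : Type) (f : A -> B) :
  injective f -> (forall y, exists x, f x = y) -> bijective f.
Proof.
move=> f_inj /choice[g gK]; exists g => // x.
by apply: f_inj; rewrite gK.
Qed.

(** The module classes ask only for bijectivity; tensor and Hom functoriality need the inverse
    packed as a linear map. *)
Lemma linear_bij_inv (R : pzRingType) (U V : lmodType R) (f : {linear U -> V}) :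
  bijective f -> exists2 g : {linear V -> U}, cancel f g & cancel g f.
Proof.
case=> g fK gK; have gL : linear g by move=> a u v; apply: (can_inj fK); rewrite linearP !gK.
pose gM := GRing.isLinear.Build R V U *:%R g gL.
pose gl : {linear V -> U} := HB.pack g gM.
by exists gl.
Qed.

(** * Functoriality of the tensor product *)

Section PureSub.
Variables (R : pzRingType) (M : lmodType R^c) (N : lmodType R).

(** The inductive step of [tens_ind] is a difference, so an induction on a factor inside [pure]
    needs additivity in this form. *)
Lemma pureBl (m m' : M) (n : N) : pure (m - m') n = pure m n - pure m' n.
Proof. by apply: (addIr (pure m' n)); rewrite -pureDl !subrK. Qed.

Lemma pureBr (m : M) (n n' : N) : pure m (n - n') = pure m n - pure m n'.
Proof. by apply: (addIr (pure m n')); rewrite -pureDr !subrK. Qed.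

End PureSub.

Section TensorMap.
Variables (R : pzRingType) (M M' : lmodType R^c) (N N' : lmodType R).
Variables (f : {linear M -> M'}) (g : {linear N -> N'}).

Definition tens_map_fun (m : M) (n : N) : tens M' N' := pure (f m) (g n).

Lemma tens_map_balanced : balanced tens_map_fun.
Proof.
split=> [n x y|m x y|m r n]; rewrite /tens_map_fun.
- by rewrite linearD pureDl.
- by rewrite linearD pureDr.
- by rewrite !linearZ pureZ.
Qed.

Definition tens_map : tens M N -> tens M' N' := tens_lift tens_map_balanced.
HB.instance Definition _ := GRing.Additive.on tens_map.

Lemma tens_mapE m n : tens_map (pure m n) = pure (f m) (g n).
Proof. exact: tens_liftE. Qed.

End TensorMap.

Lemma tens_map_bij (R : pzRingType) (M M' : lmodType R^c) (N N' : lmodType R)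
    (f : {linear M -> M'}) (g : {linear N -> N'}) :
  bijective f -> bijective g -> bijective (tens_map f g).
Proof.
move=> /linear_bij_inv[f' fK f'K] /linear_bij_inv[g' gK g'K].
exists (tens_map f' g'); elim/tens_ind=> [m n|x y IHx IHy].
- by rewrite !tens_mapE fK gK.
- by rewrite !raddfB /= IHx IHy.
- by rewrite !tens_mapE f'K g'K.
- by rewrite !raddfB /= IHx IHy.
Qed.

(** * Associativity of the tensor product *)

Section TensorAssociativity.
Variables (R S : pzRingType) (A : lmodType R^c) (B : bimodType R S).
Variable C : lmodType S.

(** The three-variable map descends in two stages: with [c] fixed it lifts to the inner product
    [rtens A B]; the result, as a function of a tensor and [c], is balanced over [S] and lifts
    again. *)
Definition assoc_r_fun (c : C) (a : A) (b : B) : tens A (ltens B C) :=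
  pure a (lpure b c).

Lemma assoc_r_fun_balanced c : balanced (assoc_r_fun c).
Proof.
split=> [b x y|a x y|a r b]; rewrite /assoc_r_fun.
- exact: pureDl.
- by rewrite -pureDr; congr pure; apply: (@pureDl _ (rmod B)).
- by rewrite pureZ ltens_scaleE.
Qed.

Definition assoc_r_slice (x : rtens A B) (c : C) : tens A (ltens B C) :=
  tens_lift (assoc_r_fun_balanced c) x.

Lemma assoc_r_slice_balanced : balanced assoc_r_slice.
Proof.
split=> [c x y|x c d|x s c]; rewrite /assoc_r_slice.
- exact: raddfD.
- elim/tens_ind: x => [a b|x y IHx IHy].
    rewrite !tens_liftE /assoc_r_fun -pureDr; congr pure.
    exact: (@pureDr _ (rmod B)).
  by rewrite !raddfB /= IHx IHy opprD addrACA.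
- elim/tens_ind: x => [a b|x y IHx IHy]; last first.
    by rewrite scalerBr !raddfB /= IHx IHy.
  rewrite -[pure a b]/(rpure a b) rtens_scaleE !tens_liftE.
  by rewrite /assoc_r_fun; congr pure; apply: (@pureZ _ (rmod B)).
Qed.

Definition assoc_r : tens (rtens A B) C -> tens A (ltens B C) :=
  tens_lift assoc_r_slice_balanced.
HB.instance Definition _ := GRing.Additive.on assoc_r.

Lemma assoc_rE a b c : assoc_r (pure (rpure a b) c) = pure a (lpure b c).
Proof. by rewrite [assoc_r _]tens_liftE [LHS]tens_liftE. Qed.

(** The same two stages, now holding [a] fixed, since the inner product is [ltens B C]. *)
Definition assoc_l_fun (a : A) (b : rmod B) (c : C) : tens (rtens A B) C :=
  pure (rpure a (b : B)) c.

Lemma assoc_l_fun_balanced a : balanced (assoc_l_fun a).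
Proof.
split=> [c x y|b x y|b r c]; rewrite /assoc_l_fun.
- by rewrite -pureDl; congr pure; apply: (@pureDr _ A B).
- exact: pureDr.
- by rewrite -pureZ rtens_scaleE.
Qed.

Definition assoc_l_slice (a : A) (x : ltens B C) : tens (rtens A B) C :=
  tens_lift (assoc_l_fun_balanced a) x.

Lemma assoc_l_slice_balanced : balanced assoc_l_slice.
Proof.
split=> [x a d|a x y|a r x]; rewrite /assoc_l_slice.
- elim/tens_ind: x => [b c|x y IHx IHy].
    rewrite !tens_liftE /assoc_l_fun -pureDl; congr pure.
    exact: pureDl.
  by rewrite !raddfB /= IHx IHy opprD addrACA.
- exact: raddfD.
- elim/tens_ind: x => [b c|x y IHx IHy]; last first.
    by rewrite scalerBr !raddfB /= IHx IHy.
  rewrite -[pure b c]/(lpure (b : B) c) ltens_scaleE !tens_liftE.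
  by rewrite /assoc_l_fun; congr pure; apply: pureZ.
Qed.

Definition assoc_l : tens A (ltens B C) -> tens (rtens A B) C :=
  tens_lift assoc_l_slice_balanced.
HB.instance Definition _ := GRing.Additive.on assoc_l.

Lemma assoc_lE a b c : assoc_l (pure a (lpure b c)) = pure (rpure a b) c.
Proof. by rewrite [assoc_l _]tens_liftE [LHS]tens_liftE. Qed.

(** A pure tensor of the outer product still has an arbitrary tensor in one slot, so a second
    induction reduces that slot to pure tensors. *)
Lemma assoc_rK : cancel assoc_r assoc_l.
Proof.
elim/tens_ind=> [x c|x y IHx IHy]; last by rewrite !raddfB /= IHx IHy.
elim/tens_ind: x => [a b|x y IHx IHy]; first by rewrite assoc_rE assoc_lE.
by rewrite pureBl !raddfB /= IHx IHy.
Qed.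

Lemma assoc_lK : cancel assoc_l assoc_r.
Proof.
elim/tens_ind=> [a x|x y IHx IHy]; last by rewrite !raddfB /= IHx IHy.
elim/tens_ind: x => [b c|x y IHx IHy]; first by rewrite assoc_lE assoc_rE.
by rewrite pureBr !raddfB /= IHx IHy.
Qed.

Lemma assoc_r_bij : bijective assoc_r.
Proof. exact: Bijective assoc_rK assoc_lK. Qed.

Lemma assoc_l_bij : bijective assoc_l.
Proof. exact: Bijective assoc_lK assoc_rK. Qed.

End TensorAssociativity.

(** * Functoriality of Hom *)

Section HomMaps.
Variables (R : pzRingType) (U V W : lmodType R).

Definition precomp (f : {linear U -> V}) (h : Defs.hom V W) : Defs.hom U W :=
  (h \o f : U -> W) : {linear U -> W}.

Definition postcomp (g : {linear V -> W}) (h : Defs.hom U V) : Defs.hom U W :=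
  (g \o h : U -> W) : {linear U -> W}.

End HomMaps.

Lemma precomp_bij (R : pzRingType) (U V W : lmodType R) (f : {linear U -> V}) :
  bijective f -> bijective (@precomp R U V W f).
Proof.
move=> /linear_bij_inv[g fK gK]; exists (precomp g) => h; apply: homP => u.
  by rewrite -[LHS]/(h (f (g u))) gK.
by rewrite -[LHS]/(h (g (f u))) fK.
Qed.

Lemma postcomp_bij (R : pzRingType) (U V W : lmodType R) (f : {linear V -> W}) :
  bijective f -> bijective (@postcomp R U V W f).
Proof.
move=> /linear_bij_inv[g fK gK]; exists (postcomp g) => h; apply: homP => u.
  exact: fK.
exact: gK.
Qed.

(** * Tensor-hom adjunction, left and right *)

Section LeftCurry.
Variables (T S : pzRingType) (M : bimodType T S) (N : lmodType S) (K : lmodType T).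

Definition curry_l_slice (h : Defs.hom (ltens M N) K) (n : N) (m : M) : K :=
  h (lpure m n).

Lemma curry_l_slice_linear h n : linear (curry_l_slice h n).
Proof.
move=> t x y; rewrite /curry_l_slice -linearP ltens_scaleE; congr (h _).
exact: (@pureDl _ (rmod M)).
Qed.

HB.instance Definition _ h n := GRing.isLinear.Build T M K *:%R
  (curry_l_slice h n) (curry_l_slice_linear h n).

Definition curry_l_fun (h : Defs.hom (ltens M N) K) (n : N) : lhom M K :=
  curry_l_slice h n : {linear M -> K}.

Lemma curry_l_fun_linear h : linear (curry_l_fun h).
Proof.
move=> s x y; apply: homP => m.
rewrite -[LHS]/(h (lpure m (s *: x + y))).
rewrite -[RHS]/(h (lpure (m *> s) x) + h (lpure m y)) -linearD; congr (h _).
rewrite /lpure pureDr -pureZ; congr (_ + _); exact: congr1.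
Qed.

HB.instance Definition _ h := GRing.isLinear.Build S N (lhom M K) *:%R
  (curry_l_fun h) (curry_l_fun_linear h).

Definition curry_l (h : Defs.hom (ltens M N) K) : Defs.hom N (lhom M K) :=
  curry_l_fun h : {linear N -> lhom M K}.

Definition uncurry_l_fun (k : Defs.hom N (lhom M K)) (m : rmod M) (n : N) : K :=
  (k n : lhom M K) (m : M).

(** Balance over [S] is the [S]-linearity of [k]: scalars act on [lhom M K] through the argument, so
    [k n (m *> s) = (s *: k n) m = k (s *: n) m]. *)
Lemma uncurry_l_balanced k : balanced (uncurry_l_fun k).
Proof.
split=> [n x y|m x y|m s n]; rewrite /uncurry_l_fun.
- exact: linearD.
- by rewrite linearD.
- by rewrite linearZ.
Qed.

Lemma uncurry_l_linear k :
  linear (tens_lift (uncurry_l_balanced k) : ltens M N -> K).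
Proof. by apply: ltens_linear => t m n; apply: linearZ. Qed.

(** Injective because a homomorphism on the tensor product is determined by pure tensors; surjective
    because the uncurried map lifts. *)
Lemma curry_l_bij : bijective curry_l.
Proof.
apply: inj_surj_bij => [h h' hh'|k].
  apply: homP; elim/tens_ind=> [m n|x y IHx IHy].
    by have := congr1 (fun k : Defs.hom N (lhom M K) => (k n : lhom M K) m) hh'.
  by rewrite !linearB /= IHx IHy.
pose f : ltens M N -> K := tens_lift (uncurry_l_balanced k).
pose fM := GRing.isLinear.Build T (ltens M N) K *:%R f (uncurry_l_linear k).
pose h : {linear ltens M N -> K} := HB.pack f fM.
exists (h : Defs.hom (ltens M N) K); apply: homP => n; apply: homP => m.
exact: tens_liftE.
Qed.

End LeftCurry.

Section RightCurry.
Variables (R S : pzRingType) (M : lmodType R^c) (V : bimodType R S).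
Variable K : lmodType S^c.

Definition curry_r_slice (h : Defs.hom (rtens M V) K) (m : M) (v : rmod V) : K :=
  h (rpure m (v : V)).

Lemma curry_r_slice_linear h m : linear (curry_r_slice h m).
Proof.
move=> s x y; rewrite /curry_r_slice -linearP (rtens_scaleE (s : S)).
congr (h _); exact: (@pureDr _ M V).
Qed.

HB.instance Definition _ h m := GRing.isLinear.Build S^c (rmod V) K *:%R
  (curry_r_slice h m) (curry_r_slice_linear h m).

Definition curry_r_fun (h : Defs.hom (rtens M V) K) (m : M) : rhom V K :=
  curry_r_slice h m : {linear rmod V -> K}.

Lemma curry_r_fun_linear h : linear (curry_r_fun h).
Proof.
move=> r x y; apply: homP => v.
rewrite -[LHS]/(h (rpure (r *: x + y) (v : V))).
rewrite -[RHS]/(h (rpure x ((r : R) *: (v : V))) + h (rpure y (v : V))).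
by rewrite -linearD /rpure pureDl pureZ.
Qed.

HB.instance Definition _ h := GRing.isLinear.Build R^c M (rhom V K) *:%R
  (curry_r_fun h) (curry_r_fun_linear h).

Definition curry_r (h : Defs.hom (rtens M V) K) : Defs.hom M (rhom V K) :=
  curry_r_fun h : {linear M -> rhom V K}.

Definition uncurry_r_fun (k : Defs.hom M (rhom V K)) (m : M) (v : V) : K :=
  (k m : rhom V K) (v : rmod V).

Lemma uncurry_r_balanced k : balanced (uncurry_r_fun k).
Proof.
split=> [v x y|m x y|m r v]; rewrite /uncurry_r_fun.
- by rewrite linearD.
- exact: (linearD (k m : rhom V K)).
- by rewrite linearZ.
Qed.

Lemma uncurry_r_linear k :
  linear (tens_lift (uncurry_r_balanced k) : rtens M V -> K).
Proof.
by apply: rtens_linear => m v s; apply: (linearZZ (k m : rhom V K)).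
Qed.

Lemma curry_r_bij : bijective curry_r.
Proof.
apply: inj_surj_bij => [h h' hh'|k].
  apply: homP; elim/tens_ind=> [m v|x y IHx IHy].
    by have := congr1 (fun k : Defs.hom M (rhom V K) => (k m : rhom V K) (v : rmod V)) hh'.
  by rewrite !linearB /= IHx IHy.
pose f : rtens M V -> K := tens_lift (uncurry_r_balanced k).
pose fM := GRing.isLinear.Build S^c (rtens M V) K *:%R f (uncurry_r_linear k).
pose h : {linear rtens M V -> K} := HB.pack f fM.
exists (h : Defs.hom (rtens M V) K); apply: homP => m; apply: homP => v.
exact: tens_liftE.
Qed.

End RightCurry.

(** * Comparison of the conditions for an injective context *)

Section InjectiveContext.
Variables (T S : pzRingType) (P : bimodType T S) (Q : bimodType S T).
Variable m : moritaSemiContext P Q.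
Notation I := (trace_ideal m).

Fact in_trace_pairing (x : btens P Q) : m x \in in_trace m.
Proof. by apply/asboolP; exists x. Qed.

Definition to_trace (x : btens P Q) : I := TraceIdeal (in_trace_pairing x).

(** Surjectivity holds because the ideal is defined as the image of the pairing; injectivity is the
    hypothesis on the context. *)
Lemma to_trace_bij : injective_context m -> bijective to_trace.
Proof.
move=> m_inj; apply: inj_surj_bij => [x y /(congr1 val)/m_inj //|[t tI]].
have /asboolP[x mx] := tI.
by exists x; apply: val_inj.
Qed.

(** One map under two module structures: the left [T]-linear form serves as a right tensor factor
    and in left Hom, the right [T]-linear form as a left tensor factor and in right Hom. *)
Definition to_trace_l : ltens P Q -> I := to_trace.
Definition to_trace_r : rtens (rmod P) Q -> rmod I := to_trace.

Lemma to_trace_l_linear : linear to_trace_l.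
Proof. by move=> t x y; apply: val_inj; apply: (linearP m). Qed.

Lemma to_trace_r_linear : linear to_trace_r.
Proof.
move=> t x y; apply: val_inj.
(* Scaling in [rtens (rmod P) Q] is by definition the right action on [btens P Q], so the second
   linearity axiom of the pairing applies. *)
rewrite -[LHS]/(m ((x : btens P Q) *> (t : T) + y)) linearD pairing_actr.
by [].
Qed.

HB.instance Definition _ := GRing.isLinear.Build T (ltens P Q) I *:%R
  to_trace_l to_trace_l_linear.
HB.instance Definition _ := GRing.isLinear.Build T^c (rtens (rmod P) Q) (rmod I)
  *:%R to_trace_r to_trace_r_linear.

Hypothesis m_inj : injective_context m.

Lemma Stat_l_C_l (U : lmodType T) : D_l m U -> Stat_l P U <-> C_l m U.
Proof.
move=> DU; pose f : {additive _ -> _} := tens_map to_trace_r (idfun : {linear U -> U}).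
pose g : {additive _ -> _} := tens_map (idfun : {linear rmod P -> rmod P}) (@delta_l _ _ _ _ m U).
have fB : bijective f by apply: tens_map_bij; [exact: to_trace_bij | exists id].
have gB : bijective g by apply: tens_map_bij; [exists id | exact: DU].
(* On a tensor of [p], [q] and [u], both sides give [bracket p q *: u]. *)
have E z : @mul_l _ _ _ _ m U (f z) =
           @eval_l _ _ P U (g (@assoc_r _ _ (rmod P) Q U z)).
  elim/tens_ind: z => [x u|x y IHx IHy]; last by rewrite !raddfB /= IHx IHy.
  elim/tens_ind: x => [p q|x y IHx IHy]; last by rewrite pureBl !raddfB /= IHx IHy.
  rewrite /= assoc_rE !tens_mapE [LHS]mul_lE [RHS]eval_lE.
  by rewrite [RHS](@delta_lE _ _ _ _ m).
apply: iff_sym; apply: bij_square_right fB (bij_comp gB (assoc_r_bij _ _ _)) E.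
Qed.

Lemma Adstat_l_L_l (U : lmodType T) : D_l m U -> Adstat_l Q U <-> L_l m U.
Proof.
move=> DU; pose f := @curry_l _ _ P Q U \o precomp to_trace_l.
pose g := @postcomp _ Q _ _ (@delta_l _ _ _ _ m U).
have fB : bijective f.
  by apply: bij_comp; [exact: curry_l_bij | apply/precomp_bij/to_trace_bij].
have gB : bijective g by apply: postcomp_bij.
(* Evaluated at [q] and then [p], both sides are [bracket p q *: u]; the left one is so by
   computation. *)
have E u : f (@act_l _ _ _ _ m U u) = g (@coeval_l _ _ Q U u).
  apply: homP => q; apply: homP => p.
  by rewrite [RHS](@delta_lE _ _ _ _ m).
apply: iff_sym; apply: bij_square_left fB gB E.
Qed.

Lemma Stat_r_C_r (U : lmodType T^c) : D_r m U -> Stat_r Q U <-> C_r m U.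
Proof.
move=> DU; pose f : {additive _ -> _} := tens_map (idfun : {linear U -> U}) to_trace_l.
pose g : {additive _ -> _} := tens_map (@delta_r _ _ _ _ m U) (idfun : {linear Q -> Q}).
have fB : bijective f by apply: tens_map_bij; [exists id | exact: to_trace_bij].
have gB : bijective g by apply: tens_map_bij; [exact: DU | exists id].
have E z : @mul_r _ _ _ _ m U (f z) =
           @eval_r _ _ Q U (g (@assoc_l _ _ U P Q z)).
  elim/tens_ind: z => [u x|x y IHx IHy]; last by rewrite !raddfB /= IHx IHy.
  elim/tens_ind: x => [p q|x y IHx IHy]; last by rewrite pureBr !raddfB /= IHx IHy.
  rewrite /= assoc_lE !tens_mapE [LHS]mul_rE [RHS]eval_rE.
  by rewrite [RHS](@delta_rE _ _ _ _ m).
apply: iff_sym; apply: bij_square_right fB (bij_comp gB (assoc_l_bij _ _ _)) E.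
Qed.

Lemma Adstat_r_L_r (U : lmodType T^c) : D_r m U -> Adstat_r P U <-> L_r m U.
Proof.
move=> DU; pose f := @curry_r _ _ (rmod P) Q U \o precomp to_trace_r.
pose g := @postcomp _ (rmod P) _ _ (@delta_r _ _ _ _ m U).
have fB : bijective f.
  by apply: bij_comp; [exact: curry_r_bij | apply/precomp_bij/to_trace_bij].
have gB : bijective g by apply: postcomp_bij.
(* Currying on the right takes [p] first and [q] second; the common value is [u] acted on by
   [bracket p q]. *)
have E u : f (@act_r _ _ _ _ m U u) = g (@coeval_r _ _ P U u).
  apply: homP => p; apply: homP => q.
  by rewrite [RHS](@delta_rE _ _ _ _ m).
apply: iff_sym; apply: bij_square_left fB gB E.
Qed.

End InjectiveContext.

Theorem theorem5p11 (T S : pzRingType) (P : bimodType T S) (Q : bimodType S T)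
    (m : moritaSemiContext P Q) (m_inj : injective_context m) :
  [/\ calV_l m =c bbV_l m,
      calW_l m =c bbW_l m,
      [/\ hatV_l m =c hatW_l m,
          hatW_l m =c calX_l m,
          calX_l m =c bbX_l m
        & bbX_l m =c C_l m `&` D_l m `&` L_l m]
    & calXstar_l m =c bbXstar_l m]
  /\
  [/\ calV_r m =c bbV_r m,
      calW_r m =c bbW_r m,
      [/\ hatV_r m =c hatW_r m,
          hatW_r m =c calX_r m,
          calX_r m =c bbX_r m
        & bbX_r m =c C_r m `&` D_r m `&` L_r m]
    & calXstar_r m =c bbXstar_r m].
Proof.
have [Vl Wl] : calV_l m =c bbV_l m /\ calW_l m =c bbW_l m.
  split=> U; rewrite /calV_l /bbV_l /calW_l /bbW_l /modClassI.
    (* [D_l] is a conjunct of both classes, so the comparison is needed only under it. *)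
    by have := @Stat_l_C_l _ _ _ _ _ m_inj U; tauto.
  by have := @Adstat_l_L_l _ _ _ _ _ m_inj U; tauto.
have [Vr Wr] : calV_r m =c bbV_r m /\ calW_r m =c bbW_r m.
  split=> U; rewrite /calV_r /bbV_r /calW_r /bbW_r /modClassI.
    by have := @Stat_r_C_r _ _ _ _ _ m_inj U; tauto.
  by have := @Adstat_r_L_r _ _ _ _ _ m_inj U; tauto.
have Xl : calX_l m =c bbX_l m by move=> U; split=> -[/Vl ? /Wl ?].
have Xr : calX_r m =c bbX_r m by move=> U; split=> -[/Vr ? /Wr ?].
split; split=> //.
(* After replacing V and W, each class is a rearrangement of the conjunction of [C_l], [D_l] and
   [L_l]. *)
- split=> // U; move: (Vl U) (Wl U);
    rewrite /hatV_l /hatW_l /calX_l /bbX_l /bbV_l /bbW_l /modClassI; tauto.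
(* Membership is literal equality with [ltens Q U], so the same [U] must serve as witness on both
   sides. *)
- by move=> L; split=> -[U /Xl XU ->]; exists U.
- split=> // U; move: (Vr U) (Wr U);
    rewrite /hatV_r /hatW_r /calX_r /bbX_r /bbV_r /bbW_r /modClassI; tauto.
- by move=> L; split=> -[U /Xr XU ->]; exists U.
Qed.
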